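(* Let $\mathcal{C}$ be a model category and let $\gamma:\mathcal{C}\rightarrow Ho(\mathcal{C})$ be the localization functor to its homotopy category. Suppose that there are a functor $Q:\mathcal{C}\rightarrow\mathcal{C}$ and a natural transformation $\alpha:Id\Rightarrow Q$ satisfying the following properties: (A1) the functor $Q$ preserves weak equivalences; (A2) for each $X\in\mathcal{C}$, the map $Q(\alpha_{X}):Q(X)\to Q(Q(X))$ is a weak equivalence and the map $\gamma(\alpha_{Q(X)})$ is a monomorphism in $Ho(\mathcal{C})$; (A3) $Q$-equivalences are stable under pullbacks along fibrations between fibrant objects $f:X\rightarrow Y$ such that $\alpha_{X}$ and $\alpha_{Y}$ are weak equivalences. (That is, for every such $f$ and every $Q$-equivalence $w:W\to Y$, the projection $W\times_Y X\to X$ is a $Q$-equivalence.) Then $\mathcal{C}$ admits a left Bousfield localization with the class of $Q$-equivalences as weak equivalences.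
   Context: ''Model category'' means Quillen model category. A map $f$ of $\mathcal{C}$ is a $Q$-equivalence if $Q(f)$ is a weak equivalence of $\mathcal{C}$. A left Bousfield localization of a model category $\mathcal{C}$ is another model category structure on the same underlying category $\mathcal{C}$ having the same class of cofibrations as the given one and a bigger class of weak equivalences (i.e. one containing the given weak equivalences). In (A1)–(A3), ''weak equivalence'', ''fibration'' and ''fibrant'' refer to the given model structure on $\mathcal{C}$. *)

(* Defs.v *)
From Stdlib Require Import List FunctionalExtensionality PropExtensionality ProofIrrelevance.
From Stdlib Require Import IndefiniteDescription Eqdep.
From mathcomp Require Import ssreflect ssrbool.

Set Implicit Arguments.
Unset Strict Implicit.
Unset Printing Implicit Defensive.

#[local] Obligation Tactic := idtac.

(** ** Categories *)

Record Category := {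
  Obj :> Type;
  Hom : Obj -> Obj -> Type;
  idc : forall x, Hom x x;
  comp : forall x y z, Hom y z -> Hom x y -> Hom x z;
  comp_idl : forall x y (f : Hom x y), comp (idc y) f = f;
  comp_idr : forall x y (f : Hom x y), comp f (idc x) = f;
  compA : forall w x y z (h : Hom y z) (g : Hom x y) (f : Hom w x),
    comp h (comp g f) = comp (comp h g) f
}.

Arguments Hom {c} x y.
Arguments idc {c} x.
Arguments comp {c x y z} g f : rename.

Notation "g ∘ f" := (comp g f) (at level 40, left associativity).

Record Functor (C D : Category) := {
  fobj :> C -> D;
  fmap : forall x y, Hom x y -> Hom (fobj x) (fobj y);
  fmap_id : forall x, fmap (idc x) = idc (fobj x);
  fmap_comp : forall x y z (g : Hom y z) (f : Hom x y),
    fmap (g ∘ f) = fmap g ∘ fmap f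
}.

Arguments fmap {C D} F {x y} f : rename.

Definition IdFunctor (C : Category) : Functor C C :=
  @Build_Functor C C (fun x => x) (fun _ _ f => f)
    (fun _ => eq_refl) (fun _ _ _ _ _ => eq_refl).

Program Definition CompFunctor (C D E : Category)
    (G : Functor D E) (F : Functor C D) : Functor C E :=
  {| fobj := fun x => G (F x); fmap := fun _ _ f => fmap G (fmap F f) |}.
Next Obligation. by move=> * /=; rewrite !fmap_id. Qed.
Next Obligation. by move=> * /=; rewrite !fmap_comp. Qed.

Record NatTrans (C D : Category) (F G : Functor C D) := {
  ntcomp :> forall x, Hom (F x) (G x);
  ntnat : forall x y (f : Hom x y), ntcomp y ∘ fmap F f = fmap G f ∘ ntcomp x
}.

Definition is_iso (C : Category) (x y : C) (f : Hom x y) : Prop :=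
  exists g : Hom y x, g ∘ f = idc x /\ f ∘ g = idc y.

Definition is_mono (C : Category) (x y : C) (f : Hom x y) : Prop :=
  forall (w : C) (g h : Hom w x), f ∘ g = f ∘ h -> g = h.

(** ** Limits and colimits *)

Record Cone (J C : Category) (F : Functor J C) := {
  apex : C;
  leg : forall j, Hom apex (F j);
  leg_nat : forall i j (u : Hom i j), fmap F u ∘ leg i = leg j
}.

Definition is_limit (J C : Category) (F : Functor J C) (K : Cone F) : Prop :=
  forall K' : Cone F,
    exists! h : Hom (apex K') (apex K), forall j, leg K j ∘ h = leg K' j.

Record Cocone (J C : Category) (F : Functor J C) := {
  coapex : C;
  coleg : forall j, Hom (F j) coapex;
  coleg_nat : forall i j (u : Hom i j), coleg j ∘ fmap F u = coleg i
}.

Definition is_colimit (J C : Category) (F : Functor J C) (K : Cocone F) : Prop :=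
  forall K' : Cocone F,
    exists! h : Hom (coapex K) (coapex K'), forall j, h ∘ coleg K j = coleg K' j.

Definition finite_type (T : Type) : Prop := exists l : list T, forall x, In x l.

Definition finite_category (J : Category) : Prop :=
  finite_type J /\ forall x y : J, finite_type (Hom x y).

Definition has_finite_limits (C : Category) : Prop :=
  forall J : Category, finite_category J ->
  forall F : Functor J C, exists K : Cone F, is_limit K.

Definition has_finite_colimits (C : Category) : Prop :=
  forall J : Category, finite_category J ->
  forall F : Functor J C, exists K : Cocone F, is_colimit K.

Definition is_terminal (C : Category) (t : C) : Prop :=
  forall x : C, exists f : Hom x t, forall g : Hom x t, g = f.

(* The square  f ∘ p = w ∘ q  exhibits P as the pullback W ×_Y X. *)
Definition is_pullback (C : Category) (W X Y P : C)
    (w : Hom W Y) (f : Hom X Y) (q : Hom P W) (p : Hom P X) : Prop :=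
  w ∘ q = f ∘ p /\
  forall (T : C) (a : Hom T W) (b : Hom T X), w ∘ a = f ∘ b ->
    exists! h : Hom T P, q ∘ h = a /\ p ∘ h = b.

(** ** Model categories *)

Definition MorClass (C : Category) := forall x y : C, Hom x y -> Prop.

Definition is_retract (C : Category) (x y x' y' : C)
    (f : Hom x y) (g : Hom x' y') : Prop :=
  exists (i : Hom x x') (r : Hom x' x) (j : Hom y y') (s : Hom y' y),
    [/\ r ∘ i = idc x, s ∘ j = idc y, g ∘ i = j ∘ f & f ∘ r = s ∘ g].

Definition closed_under_retracts (C : Category) (K : MorClass C) : Prop :=
  forall (x y x' y' : C) (f : Hom x y) (g : Hom x' y'),
    is_retract f g -> K x' y' g -> K x y f.

Definition two_out_of_three (C : Category) (K : MorClass C) : Prop :=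
  forall (x y z : C) (f : Hom x y) (g : Hom y z),
    [/\ K x y f -> K y z g -> K x z (g ∘ f),
        K x y f -> K x z (g ∘ f) -> K y z g
      & K y z g -> K x z (g ∘ f) -> K x y f].

Definition has_lifting (C : Category) (a b x y : C)
    (i : Hom a b) (p : Hom x y) : Prop :=
  forall (u : Hom a x) (v : Hom b y), p ∘ u = v ∘ i ->
    exists h : Hom b x, h ∘ i = u /\ p ∘ h = v.

(* Quillen's axioms for a (closed) model category: finite limits and colimits,
   and factorizations that need not be functorial. *)
Record ModelStructure (C : Category) := {
  weq : MorClass C;
  fib : MorClass C;
  cof : MorClass C;
  ms_limits : has_finite_limits C;
  ms_colimits : has_finite_colimits C;
  ms_two_out_of_three : two_out_of_three weq;
  ms_retract_weq : closed_under_retracts weq;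
  ms_retract_fib : closed_under_retracts fib;
  ms_retract_cof : closed_under_retracts cof;
  ms_lift_tcof_fib : forall (a b x y : C) (i : Hom a b) (p : Hom x y),
    cof i -> weq i -> fib p -> has_lifting i p;
  ms_lift_cof_tfib : forall (a b x y : C) (i : Hom a b) (p : Hom x y),
    cof i -> fib p -> weq p -> has_lifting i p;
  ms_factor_tcof_fib : forall (x y : C) (f : Hom x y),
    exists (z : C) (i : Hom x z) (p : Hom z y),
      [/\ f = p ∘ i, cof i, weq i & fib p];
  ms_factor_cof_tfib : forall (x y : C) (f : Hom x y),
    exists (z : C) (i : Hom x z) (p : Hom z y),
      [/\ f = p ∘ i, cof i, fib p & weq p]
}.

Arguments weq {C} M {x y} f : rename.
Arguments fib {C} M {x y} f : rename.
Arguments cof {C} M {x y} f : rename.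

Definition fibrant (C : Category) (M : ModelStructure C) (x : C) : Prop :=
  exists (t : C) (f : Hom x t), is_terminal t /\ fib M f.

Definition is_left_Bousfield_localization (C : Category)
    (M N : ModelStructure C) : Prop :=
  (forall (x y : C) (f : Hom x y), cof N f <-> cof M f) /\
  (forall (x y : C) (f : Hom x y), weq M f -> weq N f).

Definition Q_equivalence (C : Category) (M : ModelStructure C) (Q : Functor C C)
    (x y : C) (f : Hom x y) : Prop := weq M (fmap Q f).

(** ** Localization of a category at a class of morphisms *)

(* C[W^-1] is presented by generators and relations: it has the objects of C,
   and its morphisms are words in the morphisms of C and in formal inverses of
   members of W, modulo the congruence [word_eq]. *)
Section Localization.

Variables (C : Category) (W : MorClass C).

Inductive word : C -> C -> Type :=
| word_id x : word x x
| word_comp x y z : word y z -> word x y -> word x z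
| word_map x y : Hom x y -> word x y
| word_inv x y (w : Hom x y) : W w -> word y x.

Inductive word_eq : forall x y, word x y -> word x y -> Prop :=
| weqv_refl x y (a : word x y) : word_eq a a
| weqv_sym x y (a b : word x y) : word_eq a b -> word_eq b a
| weqv_trans x y (a b c : word x y) : word_eq a b -> word_eq b c -> word_eq a c
| weqv_comp x y z (a a' : word y z) (b b' : word x y) :
    word_eq a a' -> word_eq b b' -> word_eq (word_comp a b) (word_comp a' b')
| weqv_idl x y (a : word x y) : word_eq (word_comp (word_id y) a) a
| weqv_idr x y (a : word x y) : word_eq (word_comp a (word_id x)) a
| weqv_assoc x y z t (a : word z t) (b : word y z) (c : word x y) :
    word_eq (word_comp a (word_comp b c)) (word_comp (word_comp a b) c)
| weqv_map_id x : word_eq (word_map (idc x)) (word_id x)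
| weqv_map_comp x y z (g : Hom y z) (f : Hom x y) :
    word_eq (word_map (g ∘ f)) (word_comp (word_map g) (word_map f))
| weqv_inv_l x y (w : Hom x y) (Ww : W w) :
    word_eq (word_comp (word_inv Ww) (word_map w)) (word_id x)
| weqv_inv_r x y (w : Hom x y) (Ww : W w) :
    word_eq (word_comp (word_map w) (word_inv Ww)) (word_id y).

(* Quotient of [word x y] by [word_eq]: a morphism is an equivalence class. *)
Definition loc_hom (x y : C) : Type :=
  {P : word x y -> Prop | exists a, P = word_eq a}.

Definition cls (x y : C) (a : word x y) : loc_hom x y :=
  exist _ (word_eq a) (ex_intro _ a eq_refl).

Lemma cls_surj (x y : C) (f : loc_hom x y) : exists a, f = cls a.
Proof.
by case: f => P [a eP]; subst P; exists a; congr exist; apply: proof_irrelevance.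
Qed.

Lemma cls_eq (x y : C) (a b : word x y) : cls a = cls b <-> word_eq a b.
Proof.
split=> [e | ab].
  have -> : word_eq a b = word_eq b b by exact: (f_equal (fun f => proj1_sig f b) e).
  exact: weqv_refl.
apply: subset_eq_compat; apply: functional_extensionality => c.
apply: propositional_extensionality; split=> [ac | bc].
  exact: weqv_trans (weqv_sym ab) ac.
exact: weqv_trans ab bc.
Qed.

Definition rep (x y : C) (f : loc_hom x y) : word x y :=
  proj1_sig (constructive_indefinite_description _ (cls_surj f)).

Lemma repK (x y : C) (f : loc_hom x y) : cls (rep f) = f.
Proof. by rewrite /rep; case: constructive_indefinite_description. Qed.

Lemma rep_cls (x y : C) (a : word x y) : word_eq (rep (cls a)) a.
Proof. by apply/cls_eq; rewrite repK. Qed.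

Definition loc_comp (x y z : C) (g : loc_hom y z) (f : loc_hom x y) : loc_hom x z :=
  cls (word_comp (rep g) (rep f)).

Lemma loc_comp_cls (x y z : C) (a : word y z) (b : word x y) :
  loc_comp (cls a) (cls b) = cls (word_comp a b).
Proof. by apply/cls_eq; apply: weqv_comp; apply: rep_cls. Qed.

Program Definition Loc : Category :=
  {| Obj := C; Hom := loc_hom; idc := fun x => cls (word_id x);
     comp := loc_comp |}.
Next Obligation.
move=> x y f; have [a ->] := cls_surj f.
by rewrite loc_comp_cls; apply/cls_eq; apply: weqv_idl.
Qed.
Next Obligation.
move=> x y f; have [a ->] := cls_surj f.
by rewrite loc_comp_cls; apply/cls_eq; apply: weqv_idr.
Qed.
Next Obligation.
move=> x y z t h g f.
have [a ->] := cls_surj h; have [b ->] := cls_surj g; have [c ->] := cls_surj f.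
by rewrite !loc_comp_cls; apply/cls_eq; apply: weqv_assoc.
Qed.

Program Definition loc_functor : Functor C Loc :=
  {| fobj := fun x : C => x : Loc; fmap := fun _ _ f => cls (word_map f) |}.
Next Obligation. by move=> x; apply/cls_eq; apply: weqv_map_id. Qed.
Next Obligation.
by move=> x y z g f; rewrite /= loc_comp_cls; apply/cls_eq; apply: weqv_map_comp.
Qed.

Lemma loc_functor_inverts (x y : C) (w : Hom x y) :
  W w -> is_iso (fmap loc_functor w).
Proof.
move=> Ww; exists (cls (word_inv Ww)) => /=; rewrite !loc_comp_cls.
by split; apply/cls_eq; [apply: weqv_inv_l | apply: weqv_inv_r].
Qed.

Section Universal.

Variables (D : Category) (F : Functor C D).
Hypothesis FW : forall (x y : C) (w : Hom x y), W w -> is_iso (fmap F w).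

Definition inv_at (x y : C) (w : Hom x y) (Ww : W w) : Hom (F y) (F x) :=
  proj1_sig (constructive_indefinite_description _ (FW Ww)).

Fixpoint eval (x y : C) (a : word x y) : Hom (F x) (F y) :=
  match a in word x y return Hom (F x) (F y) with
  | word_id x => idc (F x)
  | word_comp _ _ _ a b => eval a ∘ eval b
  | word_map _ _ f => fmap F f
  | word_inv _ _ _ Ww => inv_at Ww
  end.

Lemma eval_eq (x y : C) (a b : word x y) : word_eq a b -> eval a = eval b.
Proof.
elim=> {x y a b} /=; try by move=> *; congruence.
- by move=> x y a; apply: comp_idl.
- by move=> x y a; apply: comp_idr.
- by move=> *; apply: compA.
- by move=> x; apply: fmap_id.
- by move=> *; apply: fmap_comp.
- by move=> x y w Ww; rewrite /inv_at; case: constructive_indefinite_description => g [].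
- by move=> x y w Ww; rewrite /inv_at; case: constructive_indefinite_description => g [].
Qed.

Program Definition loc_lift : Functor Loc D :=
  {| fobj := fun x : Loc => F x; fmap := fun _ _ f => eval (rep f) |}.
Next Obligation. by move=> x /=; rewrite (eval_eq (rep_cls _)). Qed.
Next Obligation. by move=> x y z g f /=; rewrite (eval_eq (rep_cls _)). Qed.

Lemma functor_eq (A B : Category) (o : A -> B)
    (h h' : forall x y, Hom x y -> Hom (o x) (o y)) i c i' c' :
  (forall x y f, h x y f = h' x y f) ->
  Build_Functor (fmap := h) i c = Build_Functor (fmap := h') i' c'.
Proof.
move=> e; have e' : h = h'.
  by do 3 (apply: functional_extensionality_dep => ?); apply: e.
by subst h'; rewrite (proof_irrelevance _ i i') (proof_irrelevance _ c c').
Qed.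

Lemma functor_eta (A B : Category) (G : Functor A B) :
  G = Build_Functor (fmap := @fmap _ _ G) (fmap_id G) (fmap_comp G).
Proof. by case: G. Qed.

Lemma loc_lift_spec : CompFunctor loc_lift loc_functor = F.
Proof.
rewrite [RHS]functor_eta; apply: functor_eq => x y f.
by rewrite /= (eval_eq (rep_cls _)).
Qed.

End Universal.

Lemma loc_unique (D : Category) (G G' : Functor Loc D) :
  CompFunctor G loc_functor = CompFunctor G' loc_functor -> G = G'.
Proof.
case: G G' => o h i c [o' h' i' c'] e.
have eo : o = o' by apply: (f_equal (fun H : Functor C D => H : C -> D) e).
subst o'; apply: functor_eq => x y f.
have {}e : (fun x y (f : @Hom C x y) => h x y (cls (word_map f)))
          = (fun x y (f : @Hom C x y) => h' x y (cls (word_map f))).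
  exact: inj_pair2 (f_equal (fun H : Functor C D =>
    existT (fun o : C -> D => forall x y : C, Hom x y -> Hom (o x) (o y))
           (fobj H) (@fmap _ _ H)) e).
have {}e (x0 y0 : C) (g : Hom x0 y0) : h _ _ (cls (word_map g)) = h' _ _ (cls (word_map g)).
  by have := f_equal (fun k => k x0 y0 g) e.
have [a ->] := cls_surj f; elim: a {f} => {x y} [x|x y z a IHa b IHb|x y g|x y w Ww].
- by rewrite [LHS]i [RHS]i'.
- by rewrite -loc_comp_cls [LHS]c [RHS]c' IHa IHb.
- exact: e.
have l : @comp Loc _ _ _ (cls (word_inv Ww)) (cls (word_map w)) = idc (x : Loc).
  by rewrite /= loc_comp_cls; apply/cls_eq; apply: weqv_inv_l.
have r : @comp Loc _ _ _ (cls (word_map w)) (cls (word_inv Ww)) = idc (y : Loc).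
  by rewrite /= loc_comp_cls; apply/cls_eq; apply: weqv_inv_r.
rewrite -[LHS]comp_idr -(i' y) -r c' -e compA -c l i.
by rewrite comp_idl.
Qed.

Theorem loc_universal (D : Category) (F : Functor C D) :
  (forall (x y : C) (w : Hom x y), W w -> is_iso (fmap F w)) ->
  exists! G : Functor Loc D, CompFunctor G loc_functor = F.
Proof.
move=> FW; exists (loc_lift FW); split; first exact: loc_lift_spec.
by move=> G e; apply: loc_unique; rewrite loc_lift_spec.
Qed.

End Localization.

Definition Ho (C : Category) (M : ModelStructure C) : Category := Loc (@weq C M).

Definition gamma (C : Category) (M : ModelStructure C) : Functor C (Ho M) :=
  loc_functor (@weq C M).

(* Main.v *)
From Stdlib Require Import List Relation_Operators ProofIrrelevance.
From Stdlib Require Import FunctionalExtensionality PropExtensionality.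
From Stdlib Require Import IndefiniteDescription.
From mathcomp Require Import ssreflect ssrfun ssrbool.
Require Import Defs.

Set Implicit Arguments.
Unset Strict Implicit.
Unset Printing Implicit Defensive.

#[local] Obligation Tactic := idtac.

(** The fibrations of the localization have to be the maps with the right lifting
    property against the cofibrations that are [Q]-equivalences, and the only
    axiom that is not formal is the factorization of a map [f : X -> Y] into
    such a cofibration followed by such a fibration.

    It is obtained from an explicit local replacement.  Let [Y'] be a fibrant
    replacement of [Q Y], and factor [Q X -> Q Y -> Y'] as a trivial cofibration
    [Q X -> X'] followed by a fibration [f' : X' -> Y'].  The maps [X -> X'] and
    [Y -> Y'] are [Q]-equivalences because [Q (alpha X)] and [Q (alpha Y)] are
    weak equivalences.  If [alpha (Q X)] is a weak equivalence for all [X], then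
    so are [alpha X'] and [alpha Y'], and two facts apply to [f'].
    - [local_fib_rlp]: [f'] has the right lifting property against cofibrations
      that are [Q]-equivalences.  Given such an [i : A -> B] and a square from [i]
      to [f'], its image under [Q] starts at the weak equivalence [Q i];
      replacing the sides of that image by fibrations to fibrant objects and pulling
      back along [alpha] factors the original square through a weak equivalence
      [E -> F], which reduces the lift to lifts in the given model structure.
    - (A3): the pullback [P] of [f'] along [Y -> Y'] maps to [X'] by a
      [Q]-equivalence, and hence so does [X] to [P].
    Factoring [X -> P] as a cofibration followed by a trivial fibration gives
    the factorization of [f] ([Q_factorization]).  The weak equivalences
    that have to be pulled back in this argument are between fibrant objects and are
    pulled back along fibrations, which preserves them in any model category
    ([weq_pullback_fibrant]).

    It remains to see that [alpha (Q X)] is a weak equivalence.  In the homotopy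
    category, naturality of [alpha] and the invertibility of [Q (alpha X)] give
    that [alpha (Q X)] and [Q (alpha X)] become equal after composition with
    [alpha (Q (Q X))], which is a monomorphism; so [alpha (Q X)] becomes
    invertible ([alpha_Q_weq]).  That a map which becomes invertible in the
    homotopy category is a weak equivalence ([weq_of_gamma_iso]) is proved by
    mapping the localization, for each cofibrant [A], to a category in which [X]
    stands for the set of homotopy classes of maps from [A] to a fibrant
    replacement of [X]; a map between fibrant objects that is bijective on these
    classes for all [A] is a weak equivalence ([weq_of_homotopy_bij]). *)

(** * Pullbacks, pushouts, terminal and initial objects *)

Program Definition thin_category (T : Type) (le : rel T)
    (le_refl : forall x, le x x)
    (le_trans : forall x y z, le y z -> le x y -> le x z) : Category :=
  {| Obj := T; Hom := fun x y => le x y; idc := le_refl; comp := le_trans |}.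
Next Obligation. by move=> *; apply: proof_irrelevance. Qed.
Next Obligation. by move=> *; apply: proof_irrelevance. Qed.
Next Obligation. by move=> *; apply: proof_irrelevance. Qed.

Lemma finite_thin_category (T : Type) (le : rel T) r t :
  finite_type T -> finite_category (@thin_category T le r t).
Proof.
move=> finT; split=> // x y /=.
case le_xy: (le x y); last by exists nil.
by exists (cons isT nil) => e; left; apply: proof_irrelevance.
Qed.

Definition empty_category : Category :=
  @thin_category Empty_set (fun _ _ => true) (fun _ => isT) (fun _ _ _ _ _ => isT).

Program Definition empty_diagram (C : Category) : Functor empty_category C :=
  @Build_Functor empty_category C (Empty_set_rect (fun _ => C)) _ _ _.
Next Obligation. by move=> C; case. Defined.
Next Obligation. by move=> C; case. Qed.
Next Obligation. by move=> C; case. Qed.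

Lemma finite_empty_category : finite_category empty_category.
Proof. by apply: finite_thin_category; exists nil; case. Qed.

Lemma has_terminal (C : Category) :
  has_finite_limits C -> exists t : C, is_terminal t.
Proof.
move=> limC; have [K limK] := limC _ finite_empty_category (empty_diagram C).
exists (apex K) => x.
have legs j : Hom x (empty_diagram C j) by case: j.
have legs_nat i j u : fmap (empty_diagram C) u ∘ legs i = legs j by case: i u.
have [h [_ uniq_h]] := limK (@Build_Cone _ _ (empty_diagram C) x legs legs_nat).
by exists h => g; apply/esym/uniq_h; case.
Qed.

Definition is_initial (C : Category) (o : C) : Prop :=
  forall x : C, exists f : Hom o x, forall g : Hom o x, g = f.

Lemma has_initial (C : Category) :
  has_finite_colimits C -> exists o : C, is_initial o.
Proof.
move=> colC; have [K colK] := colC _ finite_empty_category (empty_diagram C).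
exists (coapex K) => x.
have legs j : Hom (empty_diagram C j) x by case: j.
have legs_nat i j u : legs j ∘ fmap (empty_diagram C) u = legs i by case: i u.
have [h [_ uniq_h]] := colK (@Build_Cocone _ _ (empty_diagram C) x legs legs_nat).
by exists h => g; apply/esym/uniq_h; case.
Qed.

Inductive corner := Left | Right | Mid.

Definition corner_le (x y : corner) : bool :=
  match x, y with
  | Left, Left | Right, Right | _, Mid => true
  | _, _ => false
  end.

Lemma corner_le_refl x : corner_le x x.
Proof. by case: x. Qed.

Lemma corner_le_trans x y z : corner_le y z -> corner_le x y -> corner_le x z.
Proof. by case: x; case: y; case: z. Qed.

Lemma finite_corner : finite_type corner.
Proof. by exists (Left :: Right :: Mid :: nil)%list; case=> /=; tauto. Qed.

(** The index categories are preorders, so that their laws and the finiteness of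
    their hom-sets are immediate: [cospan] is Left -> Mid <- Right, and [span]
    is its opposite. *)
Definition cospan : Category := thin_category corner_le_refl corner_le_trans.

Definition span : Category :=
  @thin_category corner (fun x y => corner_le y x) corner_le_refl
    (fun x y z yz xy => corner_le_trans xy yz).

Section CornerDiagrams.

Context (C : Category) (l r m : C).

Definition corner_obj (x : corner) : C :=
  match x with Left => l | Right => r | Mid => m end.

Definition cospan_map (f : Hom l m) (g : Hom r m) (x y : corner) :
    corner_le x y -> Hom (corner_obj x) (corner_obj y) :=
  match x, y return corner_le x y -> Hom (corner_obj x) (corner_obj y) with
  | Left, Left => fun _ => idc l
  | Left, Mid => fun _ => f
  | Right, Right => fun _ => idc r
  | Right, Mid => fun _ => g
  | Mid, Mid => fun _ => idc m
  | Left, Right | Right, Left | Mid, _ => fun e => False_rect _ (notF e)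
  end.

Program Definition cospan_diagram (f : Hom l m) (g : Hom r m) : Functor cospan C :=
  @Build_Functor cospan C corner_obj (@cospan_map f g) _ _.
Next Obligation. by move=> f g []. Qed.
Next Obligation.
by move=> f g [] [] [] //= *; rewrite ?comp_idl ?comp_idr.
Qed.

Definition span_map (f : Hom m l) (g : Hom m r) (x y : corner) :
    corner_le y x -> Hom (corner_obj x) (corner_obj y) :=
  match x, y return corner_le y x -> Hom (corner_obj x) (corner_obj y) with
  | Left, Left => fun _ => idc l
  | Mid, Left => fun _ => f
  | Right, Right => fun _ => idc r
  | Mid, Right => fun _ => g
  | Mid, Mid => fun _ => idc m
  | Left, _ | Right, _ => fun e => False_rect _ (notF e)
  end.

Program Definition span_diagram (f : Hom m l) (g : Hom m r) : Functor span C :=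
  @Build_Functor span C corner_obj (@span_map f g) _ _.
Next Obligation. by move=> f g []. Qed.
Next Obligation.
by move=> f g [] [] [] //= *; rewrite ?comp_idl ?comp_idr.
Qed.

Definition is_pushout (f : Hom m l) (g : Hom m r) (p : C)
    (a : Hom l p) (b : Hom r p) : Prop :=
  a ∘ f = b ∘ g /\
  forall (t : C) (u : Hom l t) (v : Hom r t), u ∘ f = v ∘ g ->
    exists! h : Hom p t, h ∘ a = u /\ h ∘ b = v.

Lemma has_pullback : has_finite_limits C -> forall (f : Hom l m) (g : Hom r m),
  exists (p : C) (a : Hom p l) (b : Hom p r), is_pullback f g a b.
Proof.
move=> limC f g.
have [|K limK] := limC cospan _ (cospan_diagram f g).
  exact: finite_thin_category finite_corner.
exists (apex K), (leg K Left), (leg K Right); split=> [|t u v uv].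
  by rewrite (@leg_nat _ _ _ K Left Mid isT) (@leg_nat _ _ _ K Right Mid isT).
pose legs := fun x : corner => match x return Hom t (corner_obj x) with
  Left => u | Right => v | Mid => f ∘ u end.
have legs_nat i j e : fmap (cospan_diagram f g) e ∘ legs i = legs j.
  by case: i j e => -[] //= *; rewrite ?comp_idl.
have [h [hK uniq_h]] := limK (@Build_Cone _ _ (cospan_diagram f g) t legs legs_nat).
exists h; split; first by split; [apply: (hK Left) | apply: (hK Right)].
move=> h' [h'u h'v]; apply: uniq_h => -[] //=.
by rewrite -(@leg_nat _ _ _ K Left Mid isT) -compA h'u.
Qed.

Lemma has_pushout : has_finite_colimits C -> forall (f : Hom m l) (g : Hom m r),
  exists (p : C) (a : Hom l p) (b : Hom r p), is_pushout f g a b.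
Proof.
move=> colC f g.
have [|K colK] := colC span _ (span_diagram f g).
  exact: finite_thin_category finite_corner.
exists (coapex K), (coleg K Left), (coleg K Right); split=> [|t u v uv].
  by rewrite (@coleg_nat _ _ _ K Mid Left isT) (@coleg_nat _ _ _ K Mid Right isT).
pose legs := fun x : corner => match x return Hom (corner_obj x) t with
  Left => u | Right => v | Mid => u ∘ f end.
have legs_nat i j e : legs j ∘ fmap (span_diagram f g) e = legs i.
  by case: i j e => -[] //= *; rewrite ?comp_idr.
have [h [hK uniq_h]] := colK (@Build_Cocone _ _ (span_diagram f g) t legs legs_nat).
exists h; split; first by split; [apply: (hK Left) | apply: (hK Right)].
move=> h' [h'u h'v]; apply: uniq_h => -[] //=.
by rewrite -(@coleg_nat _ _ _ K Mid Left isT) compA h'u.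
Qed.

End CornerDiagrams.

Section PullbackCalculus.

Context (C : Category).

Lemma pullback_comm (W X Y P : C) (w : Hom W Y) (f : Hom X Y)
    (q : Hom P W) (p : Hom P X) : is_pullback w f q p -> w ∘ q = f ∘ p.
Proof. by case. Qed.

Lemma pullback_lift (W X Y P : C) (w : Hom W Y) (f : Hom X Y)
    (q : Hom P W) (p : Hom P X) : is_pullback w f q p ->
  forall (T : C) (a : Hom T W) (b : Hom T X), w ∘ a = f ∘ b ->
    exists h : Hom T P, q ∘ h = a /\ p ∘ h = b.
Proof. by move=> [_ U] T a b /U [h [? _]]; exists h. Qed.

Lemma pullback_ext (W X Y P : C) (w : Hom W Y) (f : Hom X Y)
    (q : Hom P W) (p : Hom P X) : is_pullback w f q p ->
  forall (T : C) (h h' : Hom T P), q ∘ h = q ∘ h' -> p ∘ h = p ∘ h' -> h = h'.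
Proof.
move=> [sq U] T h h' eq ep.
have [|k [_ uniq_k]] := U T (q ∘ h) (p ∘ h); first by rewrite !compA sq.
by rewrite -(uniq_k h) // -(uniq_k h').
Qed.

Lemma is_pullbackI (W X Y P : C) (w : Hom W Y) (f : Hom X Y)
    (q : Hom P W) (p : Hom P X) :
  w ∘ q = f ∘ p ->
  (forall (T : C) (a : Hom T W) (b : Hom T X), w ∘ a = f ∘ b ->
    exists h : Hom T P, q ∘ h = a /\ p ∘ h = b) ->
  (forall (T : C) (h h' : Hom T P), q ∘ h = q ∘ h' -> p ∘ h = p ∘ h' -> h = h') ->
  is_pullback w f q p.
Proof.
move=> sq ex ext; split=> // T a b /ex [h [ha hb]].
by exists h; split=> // h' [h'a h'b]; apply: ext; congruence.
Qed.

Lemma pullback_sym (W X Y P : C) (w : Hom W Y) (f : Hom X Y)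
    (q : Hom P W) (p : Hom P X) : is_pullback w f q p -> is_pullback f w p q.
Proof.
move=> pb; apply: is_pullbackI => [|T a b e|T h h' e e'].
- exact/esym/(pullback_comm pb).
- by have [h []] := pullback_lift pb (esym e); exists h.
- exact: pullback_ext pb _ _ _ e' e.
Qed.

(** Cancellation half of the pasting law. *)
Lemma pullback_cancel (V W X Y P R : C) (v : Hom V W) (w : Hom W Y) (f : Hom X Y)
    (q : Hom P W) (p : Hom P X) (s : Hom R V) (r : Hom R X) (h : Hom R P) :
  is_pullback w f q p -> is_pullback (w ∘ v) f s r ->
  q ∘ h = v ∘ s -> p ∘ h = r -> is_pullback v q s h.
Proof.
move=> pbP pbR qh ph; apply: is_pullbackI => // [T a b e|T k k' e e'].
  have [|k [ska rkb]] := pullback_lift pbR (a := a) (b := p ∘ b).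
    by rewrite -compA e !compA (pullback_comm pbP).
  exists k; split=> //; apply: (pullback_ext pbP); rewrite compA.
    by rewrite qh -compA ska.
  by rewrite ph.
by apply: (pullback_ext pbR) => //; rewrite -ph -!compA e'.
Qed.

End PullbackCalculus.
(** * Lifting properties and closure of the classes of a model structure *)

Section Lifting.

Context (C : Category).

Definition rlp (K : MorClass C) (x y : C) (p : Hom x y) : Prop :=
  forall (a b : C) (i : Hom a b), K a b i -> has_lifting i p.

Definition llp (K : MorClass C) (a b : C) (i : Hom a b) : Prop :=
  forall (x y : C) (p : Hom x y), K x y p -> has_lifting i p.

Lemma has_lifting_comp (a b x y z : C) (i : Hom a b) (p : Hom x y) (q : Hom y z) :
  has_lifting i p -> has_lifting i q -> has_lifting i (q ∘ p).
Proof.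
move=> lp lq u v e; have [|h [hi qh]] := lq (p ∘ u) v; first by rewrite compA.
have [k [ki pk]] := lp u h (esym hi).
by exists k; split=> //; rewrite -compA pk.
Qed.

Lemma has_lifting_pullback (a b W X Y P : C) (i : Hom a b) (w : Hom W Y)
    (f : Hom X Y) (q : Hom P W) (p : Hom P X) :
  is_pullback w f q p -> has_lifting i w -> has_lifting i p.
Proof.
move=> pb lw u v e.
have [|h [hi wh]] := lw (q ∘ u) (f ∘ v).
  by rewrite compA (pullback_comm pb) -!compA e.
have [k [qk pk]] := pullback_lift pb wh.
exists k; split=> //; apply: (pullback_ext pb); rewrite compA ?qk //.
by rewrite pk.
Qed.

Lemma has_lifting_retract (a b x y x' y' : C) (i : Hom a b) (p : Hom x y)
    (p' : Hom x' y') : is_retract p p' -> has_lifting i p' -> has_lifting i p.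
Proof.
move=> [s [r [s' [r' [rs rs' e e']]]]] l u v sq.
have [|h [hi ph]] := l (s ∘ u) (s' ∘ v); first by rewrite compA e -!compA sq.
exists (r ∘ h); split; first by rewrite -compA hi compA rs comp_idl.
by rewrite compA e' -compA ph compA rs' comp_idl.
Qed.

Lemma rlp_comp K (x y z : C) (p : Hom x y) (q : Hom y z) :
  rlp K p -> rlp K q -> rlp K (q ∘ p).
Proof. by move=> lp lq a b i Ki; apply: has_lifting_comp; auto. Qed.

Lemma rlp_pullback K (W X Y P : C) (w : Hom W Y)
    (f : Hom X Y) (q : Hom P W) (p : Hom P X) :
  is_pullback w f q p -> rlp K w -> rlp K p.
Proof. by move=> pb lw a b i Ki; apply: (has_lifting_pullback pb); auto. Qed.

Lemma rlp_retract K (x y x' y' : C) (p : Hom x y) (p' : Hom x' y') :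
  is_retract p p' -> rlp K p' -> rlp K p.
Proof. by move=> r l a b i Ki; apply: (has_lifting_retract r); auto. Qed.

Lemma llp_comp K (x y z : C) (p : Hom x y) (q : Hom y z) :
  llp K p -> llp K q -> llp K (q ∘ p).
Proof.
move=> lp lq a b i Ki u v e; have [|h [hp ih]] := lp _ _ _ Ki u (v ∘ q).
  by rewrite -compA.
have [k [kq ik]] := lq _ _ _ Ki h v ih.
by exists k; split=> //; rewrite compA kq.
Qed.

(** Only the lift has to be built: the two ways around agree on both legs of the
    pushout, hence are equal. *)
Lemma llp_pushout K (l r m p : C) (f : Hom m l) (g : Hom m r)
    (a : Hom l p) (b : Hom r p) : is_pushout f g a b -> llp K f -> llp K b.
Proof.
move=> [sq U] lf x y t Kt u v e.
have [|h [hf th]] := lf _ _ _ Kt (u ∘ g) (v ∘ a).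
  by rewrite compA e -!compA sq.
have [k [[ka kb] _]] := U _ h u hf.
exists k; split=> //.
have [|k' [_ uniq_k]] := U _ (v ∘ a) (v ∘ b); first by rewrite -!compA sq.
transitivity k'; first by apply/esym/uniq_k; rewrite -!compA ka kb.
exact: uniq_k.
Qed.

(** The retract argument: a map that lifts against one factor of it is a retract of
    the other factor. *)
Lemma retract_of_right_factor (x z y : C) (f : Hom x y) (i : Hom x z) (p : Hom z y) :
  f = p ∘ i -> has_lifting i f -> is_retract f p.
Proof.
move=> e l; have [|r [ri fr]] := l (idc x) p; first by rewrite comp_idr.
by exists i, r, (idc y), (idc y); split; rewrite ?comp_idl.
Qed.

Lemma retract_of_left_factor (x z y : C) (f : Hom x y) (i : Hom x z) (p : Hom z y) :
  f = p ∘ i -> has_lifting f p -> is_retract f i.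
Proof.
move=> e l; have [|s [sf ps]] := l i (idc y); first by rewrite comp_idl.
by exists (idc x), (idc x), s, p; split; rewrite ?comp_idl ?comp_idr.
Qed.

Lemma retract_of_idempotent (x y : C) (p : Hom x y) (q : Hom y x) :
  p ∘ q = idc y -> is_retract p (q ∘ p).
Proof.
by move=> e; exists (idc x), (idc x), q, p; split; rewrite ?comp_idl ?comp_idr ?compA ?e ?comp_idl.
Qed.

End Lifting.

Section ModelBasics.

Context (C : Category) (M : ModelStructure C).

Definition tcof (x y : C) (f : Hom x y) : Prop := cof M f /\ weq M f.
Definition tfib (x y : C) (f : Hom x y) : Prop := fib M f /\ weq M f.

Lemma weq_comp (x y z : C) (f : Hom x y) (g : Hom y z) :
  weq M f -> weq M g -> weq M (g ∘ f).
Proof. by move=> wf wg; case: (ms_two_out_of_three M f g) => H _ _; apply: H. Qed.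

Lemma weq_cancel_r (x y z : C) (f : Hom x y) (g : Hom y z) :
  weq M f -> weq M (g ∘ f) -> weq M g.
Proof. by move=> wf wg; case: (ms_two_out_of_three M f g) => _ H _; apply: H. Qed.

Lemma weq_cancel_l (x y z : C) (f : Hom x y) (g : Hom y z) :
  weq M g -> weq M (g ∘ f) -> weq M f.
Proof. by move=> wf wg; case: (ms_two_out_of_three M f g) => _ _ H; apply: H. Qed.

(** Two-out-of-three alone does not give this: the identity is a retract of the
    trivial fibration in any of its factorizations. *)
Lemma weq_id (x : C) : weq M (idc x).
Proof.
have [z [i [p [e _ _ wp]]]] := ms_factor_cof_tfib M (idc x).
apply: ms_retract_weq wp; apply: (retract_of_right_factor e) => u v sq.
by exists v; rewrite comp_idl; split=> //; rewrite -sq comp_idl.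
Qed.

(** The next three characterizations make closure of the classes under
    composition and base change a matter of lifting properties alone. *)
Lemma fibP (x y : C) (p : Hom x y) : fib M p <-> rlp tcof p.
Proof.
split=> [fp a b i [ci wi]|lp]; first exact: (ms_lift_tcof_fib ci wi fp).
have [z [i [q [e ci wi fq]]]] := ms_factor_tcof_fib M p.
by apply: ms_retract_fib fq; apply: (retract_of_right_factor e); apply: lp.
Qed.

Lemma tfibP (x y : C) (p : Hom x y) : tfib p <-> rlp (@cof _ M) p.
Proof.
split=> [[fp wp] a b i ci|lp]; first exact: (ms_lift_cof_tfib ci fp wp).
have [z [i [q [e ci fq wq]]]] := ms_factor_cof_tfib M p.
have ret : is_retract p q by apply: (retract_of_right_factor e); apply: lp.
by split; [apply: ms_retract_fib ret fq | apply: ms_retract_weq ret wq].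
Qed.

Lemma cofP (x y : C) (i : Hom x y) : cof M i <-> llp tfib i.
Proof.
split=> [ci a b p [fp wp]|li]; first exact: (ms_lift_cof_tfib ci fp wp).
have [z [j [q [e cj fq wq]]]] := ms_factor_cof_tfib M i.
by apply: ms_retract_cof cj; apply: (retract_of_left_factor e); apply: li.
Qed.

Lemma fib_comp (x y z : C) (p : Hom x y) (q : Hom y z) :
  fib M p -> fib M q -> fib M (q ∘ p).
Proof. by move=> /fibP lp /fibP lq; apply/fibP/rlp_comp. Qed.

Lemma tfib_comp (x y z : C) (p : Hom x y) (q : Hom y z) :
  tfib p -> tfib q -> tfib (q ∘ p).
Proof. by move=> /tfibP lp /tfibP lq; apply/tfibP/rlp_comp. Qed.

Lemma cof_comp (x y z : C) (p : Hom x y) (q : Hom y z) :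
  cof M p -> cof M q -> cof M (q ∘ p).
Proof. by move=> /cofP lp /cofP lq; apply/cofP/llp_comp. Qed.

Lemma cof_pushout (l r m p : C) (f : Hom m l) (g : Hom m r)
    (a : Hom l p) (b : Hom r p) : is_pushout f g a b -> cof M f -> cof M b.
Proof. by move=> po /cofP lf; apply/cofP/(llp_pushout po). Qed.

Section Pullback.

Context (W X Y P : C) (w : Hom W Y) (f : Hom X Y) (q : Hom P W) (p : Hom P X).
Hypothesis pb : is_pullback w f q p.

Lemma fib_pullback_r : fib M w -> fib M p.
Proof. by move=> /fibP lw; apply/fibP/(rlp_pullback pb). Qed.

Lemma fib_pullback_l : fib M f -> fib M q.
Proof. by move=> /fibP lf; apply/fibP/(rlp_pullback (pullback_sym pb)). Qed.

Lemma tfib_pullback_r : tfib w -> tfib p.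
Proof. by move=> /tfibP lw; apply/tfibP/(rlp_pullback pb). Qed.

Lemma tfib_pullback_l : tfib f -> tfib q.
Proof. by move=> /tfibP lf; apply/tfibP/(rlp_pullback (pullback_sym pb)). Qed.

End Pullback.

Lemma pullback_exists (W X Y : C) (w : Hom W Y) (f : Hom X Y) :
  exists (P : C) (q : Hom P W) (p : Hom P X), is_pullback w f q p.
Proof. exact: has_pullback (ms_limits M) w f. Qed.

Lemma fibrant_to_terminal (x t : C) (f : Hom x t) :
  fibrant M x -> is_terminal t -> fib M f.
Proof.
move=> [t' [f' [term_t' /fibP lf']]] term_t; apply/fibP=> a b i ti u v sq.
have [k _] := term_t' t; have [|h [hi _]] := lf' _ _ _ ti u (k ∘ v).
  by have [g U] := term_t' a; rewrite [LHS]U [RHS]U.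
by exists h; split=> //; have [g U] := term_t b; rewrite [LHS]U [RHS]U.
Qed.

Lemma fibrant_fib (x y : C) (p : Hom x y) : fib M p -> fibrant M y -> fibrant M x.
Proof.
by move=> fp [t [f [term_t ff]]]; exists t, (f ∘ p); split=> //; apply: fib_comp.
Qed.

Lemma fibrant_replacement (x : C) :
  exists (x' : C) (i : Hom x x'), tcof i /\ fibrant M x'.
Proof.
have [t term_t] := has_terminal (ms_limits M).
have [f _] := term_t x.
have [x' [i [p [_ ci wi fp]]]] := ms_factor_tcof_fib M f.
by exists x', i; split; [split | exists t, p].
Qed.

Lemma fibrant_extend (a b x : C) (i : Hom a b) (u : Hom a x) :
  fibrant M x -> tcof i -> exists h : Hom b x, h ∘ i = u.
Proof.
move=> [t [f [term_t ff]]] ti; have [v _] := term_t b.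
have [|h [hi _]] := (fibP f).1 ff _ _ _ ti u v.
  by have [g U] := term_t a; rewrite [LHS]U [RHS]U.
by exists h.
Qed.

Definition cofibrant (x : C) : Prop :=
  exists (o : C) (f : Hom o x), is_initial o /\ cof M f.

Lemma cofibrant_lift (a x y : C) (p : Hom x y) (v : Hom a y) :
  cofibrant a -> tfib p -> exists h : Hom a x, p ∘ h = v.
Proof.
move=> [o [f [init_o cf]]] tp; have [u _] := init_o x.
have [|h [_ ph]] := (tfibP p).1 tp _ _ _ cf u v.
  by have [g U] := init_o y; rewrite [LHS]U [RHS]U.
by exists h.
Qed.

Lemma cofibrant_replacement (x : C) :
  exists (x' : C) (p : Hom x' x), tfib p /\ cofibrant x'.
Proof.
have [o init_o] := has_initial (ms_colimits M).
have [f _] := init_o x.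
have [x' [i [p [_ ci fp wp]]]] := ms_factor_cof_tfib M f.
by exists x', p; split; [split | exists o, i].
Qed.

End ModelBasics.
(** * Right properness for fibrant objects *)

Section FibrantPullback.

Context (C : Category) (M : ModelStructure C).

(** K. Brown's factorization of a weak equivalence between objects fibrant over
    [Z]: a section of a trivial fibration, followed by a trivial fibration.
    The object [N] is fibred over the product of [E] and [E'] over [Z], which is
    what the lifting clause records; for [g] an identity, [N] is a path object. *)
Lemma brown_factorization (Z E E' : C) (f : Hom E Z) (f' : Hom E' Z) (g : Hom E E') :
  fib M f -> fib M f' -> weq M g -> f' ∘ g = f ->
  exists (N : C) (s : Hom E N) (r : Hom N E) (q : Hom N E'),
    [/\ r ∘ s = idc E, q ∘ s = g, tfib M r, tfib M q & f ∘ r = f' ∘ q] /\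
    (forall (a b : C) (j : Hom a b) (k : Hom a N) (u : Hom b E) (v : Hom b E'),
       tcof M j -> r ∘ k = u ∘ j -> q ∘ k = v ∘ j -> f ∘ u = f' ∘ v ->
       exists h : Hom b N, r ∘ h = u /\ q ∘ h = v).
Proof.
move=> ff ff' wg e; have [P [pl [pr pb]]] := pullback_exists M f f'.
have [|d [dl dr]] := pullback_lift pb (a := idc E) (b := g).
  by rewrite comp_idr e.
have [N [s [p [def_d cs ws fp]]]] := ms_factor_tcof_fib M d.
have rs : pl ∘ p ∘ s = idc E by rewrite -compA -def_d dl.
have qs : pr ∘ p ∘ s = g by rewrite -compA -def_d dr.
exists N, s, (pl ∘ p), (pr ∘ p); split; first split=> //.
- split; first exact: fib_comp fp (fib_pullback_l pb ff').
  by apply: (weq_cancel_r ws); rewrite rs; apply: weq_id.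
- split; first exact: fib_comp fp (fib_pullback_r pb ff).
  by apply: (weq_cancel_r ws); rewrite qs.
- by rewrite !compA (pullback_comm pb).
move=> a b j k u v tj ru qv fuv; have [w [wu wv]] := pullback_lift pb fuv.
have [|h [_ ph]] := (fibP M p).1 fp _ _ _ tj k w.
  by apply: (pullback_ext pb); rewrite !compA ?wu ?wv ?ru ?qv.
by exists h; rewrite -!compA ph.
Qed.

(** By the pasting law [h] is a base change of [t]; the lift is built directly. *)
Lemma rlp_pullback_map (K : MorClass C) (A B E E' P P' : C) (j : Hom A B)
    (f : Hom E B) (f' : Hom E' B) (t : Hom E E')
    (a : Hom P A) (e : Hom P E) (a' : Hom P' A) (e' : Hom P' E') (h : Hom P P') :
  is_pullback j f a e -> is_pullback j f' a' e' ->
  f' ∘ t = f -> a' ∘ h = a -> e' ∘ h = t ∘ e -> rlp K t -> rlp K h.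
Proof.
move=> pb pb' ft ah eh lt x y i Ki u v sq.
have [|k [ki tk]] := lt _ _ _ Ki (e ∘ u) (e' ∘ v).
  by rewrite compA -eh -!compA sq.
have [|l [al el]] := pullback_lift pb (a := a' ∘ v) (b := k).
  by rewrite compA (pullback_comm pb') -compA -tk compA ft.
exists l; split.
  by apply: (pullback_ext pb); rewrite compA ?al ?el // -ah -!compA sq.
apply: (pullback_ext pb'); rewrite compA ?ah // eh -compA el tk //.
Qed.

(** Base change along [j] preserves trivial fibrations between objects over [B],
    hence, by Brown's factorization, weak equivalences between fibrant ones. *)
Lemma weq_pullback_map (A B E E' P P' : C) (j : Hom A B)
    (f : Hom E B) (f' : Hom E' B) (g : Hom E E')
    (a : Hom P A) (e : Hom P E) (a' : Hom P' A) (e' : Hom P' E') (h : Hom P P') :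
  is_pullback j f a e -> is_pullback j f' a' e' ->
  fib M f -> fib M f' -> weq M g ->
  f' ∘ g = f -> a' ∘ h = a -> e' ∘ h = g ∘ e -> weq M h.
Proof.
move=> pb pb' ff ff' wg fg ah eh.
have [N [s [r [q [[rs qs tr tq frq] _]]]]] := brown_factorization ff ff' wg fg.
have [R [b [n pbN]]] := pullback_exists M j (f ∘ r).
have [|rA [brA nrA]] := pullback_lift pb (a := b) (b := r ∘ n).
  by rewrite (pullback_comm pbN) compA.
have [|qA [bqA nqA]] := pullback_lift pb' (a := b) (b := q ∘ n).
  by rewrite (pullback_comm pbN) compA frq.
have [|sA [bsA nsA]] := pullback_lift pbN (a := a) (b := s ∘ e).
  by rewrite (pullback_comm pb) -(compA f r) (compA r s) rs comp_idl.
have trA : tfib M rA.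
  by apply/tfibP/(rlp_pullback_map pbN pb _ brA nrA) => //; apply/tfibP.
have tqA : tfib M qA.
  by apply/tfibP/(rlp_pullback_map pbN pb' _ bqA nqA) => //; apply/tfibP.
have rsA : rA ∘ sA = idc P.
  apply: (pullback_ext pb); rewrite comp_idr compA ?brA //.
  by rewrite nrA -compA nsA compA rs comp_idl.
have qsA : qA ∘ sA = h.
  apply: (pullback_ext pb'); rewrite compA ?bqA ?bsA //.
  by rewrite nqA -compA nsA compA qs eh.
rewrite -qsA; apply: weq_comp tqA.2; apply: (weq_cancel_l trA.2).
by rewrite rsA; apply: weq_id.
Qed.

(** Let [S] be the base change of [r ∘ p] along [r].  The map [d = (id, p)] from
    [E] to [S] is a weak equivalence between fibrations over [B].  Since
    [r ∘ j = id], the base change of [S] along [j] is [E] itself, and the base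
    change of [d] is the map [e]: so [weq_pullback_map] applies. *)
Lemma weq_pullback_section (A B E P : C) (j : Hom A B) (r : Hom B A) (p : Hom E B)
    (a : Hom P A) (e : Hom P E) :
  tfib M r -> r ∘ j = idc A -> fib M p -> is_pullback j p a e -> weq M e.
Proof.
move=> tr rj fp pb.
have [S [s1 [s2 pbS]]] := pullback_exists M (r ∘ p) r.
have ts1 : tfib M s1 := tfib_pullback_l pbS tr.
have fs2 : fib M s2 := fib_pullback_r pbS (fib_comp fp tr.1).
have [|d [d1 d2]] := pullback_lift pbS (a := idc E) (b := p); first exact: comp_idr.
(* [c] exhibits [E] as the base change of [S] along [j]. *)
have [|c [c1 c2]] := pullback_lift pbS (a := idc E) (b := j ∘ (r ∘ p)).
  by rewrite comp_idr compA rj comp_idl.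
have pbE : is_pullback j s2 (r ∘ p) c.
  apply: is_pullbackI => // [T x y xy|T h h' _ ch].
    have rpy : r ∘ p ∘ (s1 ∘ y) = x.
      by rewrite compA (pullback_comm pbS) -compA -xy compA rj comp_idl.
    exists (s1 ∘ y); split=> //.
    apply: (pullback_ext pbS); rewrite compA ?c1 ?comp_idl //.
    by rewrite c2 -compA rpy.
  by rewrite -(comp_idl h) -(comp_idl h') -c1 -!compA ch.
have wd : weq M d by apply: (weq_cancel_l ts1.2); rewrite d1; apply: weq_id.
apply: (weq_pullback_map pb pbE fp fs2 wd d2).
  by rewrite -compA -(pullback_comm pb) compA rj comp_idl.
apply: (pullback_ext pbS); rewrite !compA ?c1 ?d1 // c2 d2.
by rewrite -!compA -(pullback_comm pb) (compA r j) rj comp_idl.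
Qed.

(** Brown's factorization over the terminal object splits [w] into a section of a
    trivial fibration and a trivial fibration, and each part can be pulled back. *)
Lemma weq_pullback_fibrant (W X Y P : C) (w : Hom W Y) (f : Hom X Y)
    (q : Hom P W) (p : Hom P X) :
  fibrant M W -> fibrant M Y -> weq M w -> fib M f -> is_pullback w f q p ->
  weq M p.
Proof.
move=> fW fY ww ff pb; have [t term_t] := has_terminal (ms_limits M).
have [tY _] := term_t Y.
have [N [s [r [v [[rs vs tr tv _] _]]]]] := brown_factorization
    (fibrant_to_terminal (tY ∘ w) fW term_t)
    (fibrant_to_terminal tY fY term_t) ww (erefl _).
have [P1 [n [x pb1]]] := pullback_exists M v f.
have tx : tfib M x := tfib_pullback_r pb1 tv.
have [|h [nh xh]] := pullback_lift pb1 (a := s ∘ q) (b := p).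
  by rewrite compA vs (pullback_comm pb).
rewrite -xh; apply: weq_comp tx.2.
apply: (weq_pullback_section tr rs (fib_pullback_l pb1 ff)).
by apply: (pullback_cancel pb1 _ nh xh); rewrite vs.
Qed.

End FibrantPullback.
(** * Left homotopies *)

Section Homotopy.

Context (C : Category) (M : ModelStructure C).

(** The last clause says that the map from the coproduct of two copies of [A]
    to [Z] given by [i0] and [i1] is a cofibration, without naming that coproduct. *)
Definition is_cylinder (A Z : C) (i0 i1 : Hom A Z) (s : Hom Z A) : Prop :=
  [/\ tcof M i0, tcof M i1, s ∘ i0 = idc A & s ∘ i1 = idc A] /\
  (forall (x y : C) (t : Hom x y) (u v : Hom A x) (H : Hom Z y),
     tfib M t -> H ∘ i0 = t ∘ u -> H ∘ i1 = t ∘ v ->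
     exists K : Hom Z x, [/\ K ∘ i0 = u, K ∘ i1 = v & t ∘ K = H]).

(** A coproduct of two copies of [A] is a pushout under the initial object, so its
    two injections are cofibrations when [A] is cofibrant. *)
Lemma cylinder_exists (A : C) :
  cofibrant M A -> exists (Z : C) (i0 i1 : Hom A Z) (s : Hom Z A), is_cylinder i0 i1 s.
Proof.
move=> [o [f [init_o cf]]].
have from_o (x : C) (u v : Hom o x) : u = v.
  by have [g U] := init_o x; rewrite (U u) (U v).
have [S [a [b po]]] := has_pushout (ms_colimits M) f f.
have [sq U] := po.
have po' : is_pushout f f b a.
  split=> // t u v /esym /U [h [[hv hu] uniq_h]].
  by exists h; split=> // h' [h'u h'v]; apply: uniq_h.
have [fold [[fold_a fold_b] _]] := U A (idc A) (idc A) erefl.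
have [Z [k [s [e ck fs ws]]]] := ms_factor_cof_tfib M fold.
have sa : s ∘ (k ∘ a) = idc A by rewrite compA -e.
have sb : s ∘ (k ∘ b) = idc A by rewrite compA -e.
exists Z, (k ∘ a), (k ∘ b), s; split; first split=> //.
- split; first exact: cof_comp (cof_pushout po' cf) ck.
  by apply: (weq_cancel_l ws); rewrite sa; apply: weq_id.
- split; first exact: cof_comp (cof_pushout po cf) ck.
  by apply: (weq_cancel_l ws); rewrite sb; apply: weq_id.
move=> x y t u v H tt Hu Hv.
have [h [[ha hb] _]] := U _ u v (from_o _ _ _).
have [|K [Kk tK]] := (tfibP M t).1 tt _ _ _ ck h H.
  have [w [_ uniq_w]] := U _ (t ∘ u) (t ∘ v) (from_o _ _ _).
  transitivity w; first by apply/esym/uniq_w; rewrite -!compA ha hb.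
  by apply: uniq_w; rewrite -!compA.
by exists K; split; rewrite ?compA ?Kk.
Qed.

Definition left_homotopic (A X : C) (f g : Hom A X) : Prop :=
  exists (Z : C) (i0 i1 : Hom A Z) (s : Hom Z A) (H : Hom Z X),
    [/\ is_cylinder i0 i1 s, H ∘ i0 = f & H ∘ i1 = g].

(** Taking the generated equivalence relation avoids proving that left homotopy is
    transitive: every property used below passes along chains. *)
Definition homotopic (A X : C) : Hom A X -> Hom A X -> Prop :=
  clos_refl_sym_trans _ (@left_homotopic A X).

Notation "f ≈ g" := (homotopic f g) (at level 70).

Lemma homotopic_refl (A X : C) (f : Hom A X) : f ≈ f.
Proof. exact: rst_refl. Qed.

Lemma homotopic_sym (A X : C) (f g : Hom A X) : f ≈ g -> g ≈ f.
Proof. exact: rst_sym. Qed.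

Lemma homotopic_trans (A X : C) (f g h : Hom A X) : f ≈ g -> g ≈ h -> f ≈ h.
Proof. exact: rst_trans. Qed.

Lemma homotopic_post (A X Y : C) (h : Hom X Y) (f g : Hom A X) :
  f ≈ g -> h ∘ f ≈ h ∘ g.
Proof.
elim=> {f g} [f g [Z [i0 [i1 [s [H [cyl Hf Hg]]]]]]|f|f g _|f g k _ fg _].
- by apply: rst_step; exists Z, i0, i1, s, (h ∘ H); rewrite -!compA Hf Hg.
- exact: homotopic_refl.
- exact: homotopic_sym.
- exact: homotopic_trans.
Qed.

Lemma weq_homotopic (A X : C) (f g : Hom A X) : f ≈ g -> weq M f <-> weq M g.
Proof.
elim=> {f g} [f g [Z [i0 [i1 [s [H [[[t0 t1 _ _] _] <- <-]]]]]]|f|f g _|f g k _ fg _];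
  try tauto.
split=> w; [apply: weq_comp t1.2 _|apply: weq_comp t0.2 _].
- exact: weq_cancel_r t0.2 w.
- exact: weq_cancel_r t1.2 w.
Qed.

(** Homotopy lifting along a fibration, read off for the existence of strict lifts. *)
Lemma fib_lift_homotopic (A X Y : C) (p : Hom X Y) (f g : Hom A Y) :
  fib M p -> f ≈ g -> (exists u, p ∘ u = f) <-> (exists u, p ∘ u = g).
Proof.
move=> /fibP lp.
elim=> {f g} [f g [Z [i0 [i1 [s [H [[[t0 t1 _ _] _] <- <-]]]]]]|f|f g _|f g k _ fg _];
  try tauto.
split=> -[u pu].
  have [K [_ pK]] := lp _ _ _ t0 u H pu.
  by exists (K ∘ i1); rewrite compA pK.
have [K [_ pK]] := lp _ _ _ t1 u H pu.
by exists (K ∘ i0); rewrite compA pK.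
Qed.

Section CofibrantSource.

Context (A : C) (cofA : cofibrant M A).

(** The constant homotopy at [t ∘ u] lifts through [t], relative to its ends. *)
Lemma tfib_eq_homotopic (X Y : C) (t : Hom X Y) (u v : Hom A X) :
  tfib M t -> t ∘ u = t ∘ v -> u ≈ v.
Proof.
move=> tt e; have [Z [i0 [i1 [s cyl]]]] := cylinder_exists cofA.
have [[_ _ s0 s1] lift] := cyl.
have [||K [Ku Kv _]] := lift _ _ t u v (t ∘ u ∘ s) tt.
- by rewrite -!compA s0 comp_idr.
- by rewrite -compA s1 comp_idr.
by apply: rst_step; exists Z, i0, i1, s, K.
Qed.

Lemma tfib_reflects_homotopic (X Y : C) (t : Hom X Y) (u v : Hom A X) :
  tfib M t -> t ∘ u ≈ t ∘ v -> u ≈ v.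
Proof.
move=> tt; suff gen (f g : Hom A Y) : f ≈ g -> forall u v, t ∘ u = f -> t ∘ v = g -> u ≈ v.
  by move=> e; apply: (gen _ _ e).
elim=> {u v f g} [f g|f|f g _ IH|f g h _ IH1 _ IH2].
- move=> [Z [i0 [i1 [s [H [cyl Hf Hg]]]]]] u v ef eg; have [_ lift] := cyl.
  have [||K [Ku Kv _]] := lift _ _ t u v H tt; try congruence.
  by apply: rst_step; exists Z, i0, i1, s, K.
- by move=> u v <- /esym; apply: tfib_eq_homotopic.
- by move=> u v ef eg; apply/homotopic_sym/IH.
- move=> u v ef eh; have [w ew] := cofibrant_lift g cofA tt.
  by apply: (@homotopic_trans _ _ _ w); [apply: IH1|apply: IH2].
Qed.

Definition homotopy_bij (X Y : C) (f : Hom X Y) : Prop :=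
  (forall b : Hom A Y, exists a, f ∘ a ≈ b) /\
  (forall a a' : Hom A X, f ∘ a ≈ f ∘ a' -> a ≈ a').

Lemma homotopy_bij_tfib (X Y : C) (t : Hom X Y) : tfib M t -> homotopy_bij t.
Proof.
move=> tt; split=> [b|a a']; last exact: tfib_reflects_homotopic.
by have [a <-] := cofibrant_lift b cofA tt; exists a; apply: homotopic_refl.
Qed.

Lemma homotopy_bij_id (X : C) : homotopy_bij (idc X).
Proof.
split=> [b|a a']; last by rewrite !comp_idl.
by exists b; rewrite comp_idl; apply: homotopic_refl.
Qed.

Lemma homotopy_bij_comp (X Y Z : C) (f : Hom X Y) (g : Hom Y Z) :
  homotopy_bij f -> homotopy_bij g -> homotopy_bij (g ∘ f).
Proof.
move=> [sf jf] [sg jg]; split=> [c|a a'].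
  have [b gb] := sg c; have [a fa] := sf b; exists a.
  by rewrite -compA; apply: homotopic_trans gb; apply: homotopic_post.
by rewrite -!compA => /jg /jf.
Qed.

Lemma homotopy_bij_cancel_l (X Y Z : C) (f : Hom X Y) (g : Hom Y Z) :
  homotopy_bij g -> homotopy_bij (g ∘ f) -> homotopy_bij f.
Proof.
move=> [sg jg] [s j]; split=> [b|a a' e].
  by have [a e] := s (g ∘ b); exists a; apply: jg; rewrite compA.
by apply: j; rewrite -!compA; apply: homotopic_post.
Qed.

Lemma homotopy_bij_cancel_r (X Y Z : C) (f : Hom X Y) (g : Hom Y Z) :
  homotopy_bij f -> homotopy_bij (g ∘ f) -> homotopy_bij g.
Proof.
move=> [sf jf] [s j]; split=> [c|b b' e].
  by have [a e] := s c; exists (f ∘ a); rewrite compA.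
have [a fa] := sf b; have [a' fa'] := sf b'.
apply: (homotopic_trans (homotopic_sym fa)); apply: (homotopic_trans _ fa').
apply/homotopic_post/j; rewrite -!compA.
apply: (homotopic_trans (homotopic_post g fa)).
apply: (homotopic_trans e); apply: homotopic_post; exact: homotopic_sym.
Qed.

Lemma homotopy_bij_weq (X Y : C) (w : Hom X Y) :
  fibrant M X -> fibrant M Y -> weq M w -> homotopy_bij w.
Proof.
move=> fX fY ww; have [t term_t] := has_terminal (ms_limits M).
have [tY _] := term_t Y.
have [N [s [r [q [[rs qs tr tq _] _]]]]] := brown_factorization
    (fibrant_to_terminal (tY ∘ w) fX term_t)
    (fibrant_to_terminal tY fY term_t) ww (erefl _).
rewrite -qs; apply: homotopy_bij_comp (homotopy_bij_tfib tq).
by apply: (homotopy_bij_cancel_l (homotopy_bij_tfib tr)); rewrite rs; apply: homotopy_bij_id.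
Qed.

(** [u] and [v] are right homotopic, by extending a constant homotopy along [s] into
    a path object [N] of [Y].  The resulting map [H ∘ a] into [N] is left homotopic
    to the constant path at its origin, the evaluation [r] being a trivial
    fibration; evaluating at the other end turns this into the claim. *)
Lemma tcof_eq_homotopic (K L Y : C) (s : Hom K L) (u v : Hom L Y) (a : Hom A L) :
  tcof M s -> fibrant M Y -> u ∘ s = v ∘ s -> u ∘ a ≈ v ∘ a.
Proof.
move=> ts fY e; have [t term_t] := has_terminal (ms_limits M).
have [tY _] := term_t Y; have ftY := fibrant_to_terminal tY fY term_t.
have [N [c [r [q [[rc qc tr tq _] lift]]]]] :=
  brown_factorization ftY ftY (weq_id M Y) (comp_idr tY).
have [|||H [rH qH]] := lift _ _ s (c ∘ u ∘ s) u v ts.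
- by rewrite !compA rc comp_idl.
- by rewrite !compA qc comp_idl.
- by have [g U] := term_t L; rewrite [LHS]U [RHS]U.
have /(homotopic_post q) : H ∘ a ≈ c ∘ (u ∘ a).
  by apply: (tfib_eq_homotopic tr); rewrite !compA rH rc comp_idl.
by rewrite !compA qH qc comp_idl => /homotopic_sym.
Qed.

End CofibrantSource.

(** One may replace [f] by a fibration [q] between cofibrant objects.  Bijectivity
    gives a right inverse of [q] up to homotopy, then a strict one [r] by homotopy
    lifting, and injectivity makes [r ∘ q] homotopic to the identity.  So [r ∘ q]
    is a weak equivalence, and [q] is a retract of it. *)
Lemma weq_of_homotopy_bij (X Y : C) (f : Hom X Y) :
  fibrant M X -> fibrant M Y -> (forall A, cofibrant M A -> homotopy_bij A f) -> weq M f.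
Proof.
move=> fX fY bij_f.
have [X1 [i [p [e ci wi fp]]]] := ms_factor_tcof_fib M f.
have [Y' [c [tc cofY']]] := cofibrant_replacement M Y.
have [P [p' [c' pb]]] := pullback_exists M c p.
have tc' : tfib M c' := tfib_pullback_r pb tc.
have [Z [d [td cofZ]]] := cofibrant_replacement M P.
pose q := p' ∘ d.
have fq : fib M q by apply: fib_comp td.1 (fib_pullback_l pb fp).
have sq : c ∘ q = p ∘ (c' ∘ d) by rewrite !compA (pullback_comm pb).
have bij_q A : cofibrant M A -> homotopy_bij A q.
  move=> cofA; apply: (homotopy_bij_cancel_l (homotopy_bij_tfib cofA tc)); rewrite sq.
  apply: homotopy_bij_comp; first exact/(homotopy_bij_tfib cofA)/(tfib_comp td tc').
  apply: (homotopy_bij_cancel_r (f := i)); last by rewrite -e; apply: bij_f.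
  exact: (homotopy_bij_weq cofA fX (fibrant_fib fp fY) wi).
(* The inverse up to homotopy is made strict by lifting along the fibration. *)
have [r qr] : exists r, q ∘ r = idc Y'.
  have [r0 qr0] := (bij_q _ cofY').1 (idc Y').
  by apply/(fib_lift_homotopic fq qr0); exists r0.
have rq : r ∘ q ≈ idc Z.
  apply: (bij_q _ cofZ).2; rewrite compA qr comp_idl comp_idr.
  exact: homotopic_refl.
have wq : weq M q.
  apply: ms_retract_weq (retract_of_idempotent qr) _.
  exact/(weq_homotopic rq)/weq_id.
rewrite e; apply: (weq_comp wi).
apply: (weq_cancel_r (weq_comp td.2 tc'.2)); rewrite -sq.
exact: weq_comp wq tc.2.
Qed.

End Homotopy.
(** * Saturation of the weak equivalences *)

Section Saturation.

Context (C : Category) (M : ModelStructure C).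

Notation "f ≈ g" := (homotopic M f g) (at level 70).

Lemma fibrant_replacement_choice :
  exists (R : C -> C) (eta : forall x, Hom x (R x)),
    forall x, tcof M (eta x) /\ fibrant M (R x).
Proof.
pose R x := constructive_indefinite_description _ (fibrant_replacement M x).
pose eta x := constructive_indefinite_description _ (proj2_sig (R x)).
by exists (fun x => proj1_sig (R x)), (fun x => proj1_sig (eta x)) => x; apply: (proj2_sig (eta x)).
Qed.

Context (R : C -> C) (eta : forall x, Hom x (R x)).
Hypothesis tcof_eta : forall x, tcof M (eta x).
Hypothesis fibrant_R : forall x, fibrant M (R x).
Context (A : C) (cofA : cofibrant M A).

(** The morphisms of the target category: relations between the homotopy classes
    of maps from [A] to [R x] and to [R y], as saturated relations on representatives.
    With relations, neither quotients nor a choice of extensions of [f] to the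
    replacements are needed, the inverse of a bijection is its converse, and the
    objects remain those of [C]. *)
Definition class_rel (x y : C) : Type :=
  {S : Hom A (R x) -> Hom A (R y) -> Prop |
    forall a a' b b', a ≈ a' -> b ≈ b' -> S a b -> S a' b'}.

Definition related (x y : C) (S : class_rel x y) a b : Prop := proj1_sig S a b.

Lemma related_homotopic (x y : C) (S : class_rel x y) a a' b b' :
  a ≈ a' -> b ≈ b' -> related S a b -> related S a' b'.
Proof. exact: (proj2_sig S). Qed.

Lemma class_rel_ext (x y : C) (S T : class_rel x y) :
  (forall a b, related S a b <-> related T a b) -> S = T.
Proof.
case: S T => S satS [T satT] /= e; apply: subset_eq_compat.
apply: functional_extensionality => a; apply: functional_extensionality => b.
exact/propositional_extensionality/e.
Qed.

Program Definition class_rel_id (x : C) : class_rel x x :=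
  exist _ (fun a b => a ≈ b) _.
Next Obligation.
move=> x a a' b b' aa bb ab.
exact: (homotopic_trans (homotopic_sym aa) (homotopic_trans ab bb)).
Qed.

Program Definition class_rel_comp (x y z : C) (T : class_rel y z) (S : class_rel x y) :
    class_rel x z :=
  exist _ (fun a c => exists b, related S a b /\ related T b c) _.
Next Obligation.
move=> x y z T S a a' c c' aa cc [b [ab bc]]; exists b; split.
  exact: related_homotopic aa (homotopic_refl _ _) ab.
exact: related_homotopic (homotopic_refl _ _) cc bc.
Qed.

Program Definition class_rel_inv (x y : C) (S : class_rel x y) : class_rel y x :=
  exist _ (fun b a => related S a b) _.
Next Obligation. by move=> x y S b b' a a' bb aa; apply: related_homotopic. Qed.

Program Definition class_category : Category :=
  {| Obj := C; Hom := class_rel; idc := class_rel_id; comp := class_rel_comp |}.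
Next Obligation.
move=> x y S; apply: class_rel_ext => a b; split=> [[c [ac cb]]|ab].
  exact: related_homotopic (homotopic_refl _ _) cb ac.
by exists b; split=> //; apply: homotopic_refl.
Qed.
Next Obligation.
move=> x y S; apply: class_rel_ext => a b; split=> [[c [ac cb]]|ab].
  exact: related_homotopic (homotopic_sym ac) (homotopic_refl _ _) cb.
by exists a; split=> //; apply: homotopic_refl.
Qed.
Next Obligation.
move=> w x y z U T S; apply: class_rel_ext => a d; split.
  by move=> [c [[b [ab bc]] cd]]; exists b; split=> //; exists c.
by move=> [b [ab [c [bc cd]]]]; exists c; split=> //; exists b.
Qed.

Program Definition class_graph (x y : C) (f : Hom x y) : class_rel x y :=
  exist _ (fun a b => exists2 r, r ∘ eta x = eta y ∘ f & r ∘ a ≈ b) _.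
Next Obligation.
move=> x y f a a' b b' aa bb [r re ab]; exists r => //.
apply: (homotopic_trans _ bb); apply: (homotopic_trans _ ab).
exact/homotopic_post/homotopic_sym.
Qed.

(** The extension [r] of [f] to the replacements is unique up to homotopy on maps
    out of [A], so the graph may be computed with any extension. *)
Lemma related_graph (x y : C) (f : Hom x y) (r : Hom (R x) (R y)) a b :
  r ∘ eta x = eta y ∘ f -> related (class_graph f) a b <-> r ∘ a ≈ b.
Proof.
move=> re; split=> [[r' re' ab]|ab]; last by exists r.
apply: (homotopic_trans _ ab).
by apply: (tcof_eq_homotopic cofA a (tcof_eta x) (fibrant_R y)); rewrite re.
Qed.

Lemma extends_to_R (x y : C) (f : Hom x y) : exists r, r ∘ eta x = eta y ∘ f.
Proof. exact: fibrant_extend (fibrant_R y) (tcof_eta x). Qed.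

Program Definition class_functor : Functor C class_category :=
  @Build_Functor C class_category (fun x => x) class_graph _ _.
Next Obligation.
move=> x; apply: class_rel_ext => a b.
have e : idc (R x) ∘ eta x = eta x ∘ idc x by rewrite comp_idl comp_idr.
by rewrite (related_graph _ _ e) comp_idl.
Qed.
Next Obligation.
move=> x y z g f; apply: class_rel_ext => a c.
have [r re] := extends_to_R f; have [s se] := extends_to_R g.
have e : s ∘ r ∘ eta x = eta z ∘ (g ∘ f) by rewrite -compA re !compA se.
rewrite (related_graph _ _ e); split=> [ac|[b []]].
  exists (r ∘ a); split; first by apply/(related_graph _ _ re); apply: homotopic_refl.
  by apply/(related_graph _ _ se); rewrite compA.
move=> /(related_graph _ _ re) ab /(related_graph _ _ se) bc.
by rewrite -compA; apply: homotopic_trans bc; apply: homotopic_post.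
Qed.

Lemma class_functor_inverts (x y : C) (w : Hom x y) :
  weq M w -> is_iso (fmap class_functor w).
Proof.
move=> ww; have [r re] := extends_to_R w.
have wr : weq M r.
  by apply: (weq_cancel_r (tcof_eta x).2); rewrite re; apply: weq_comp (tcof_eta y).2.
have [sr jr] := homotopy_bij_weq cofA (fibrant_R x) (fibrant_R y) wr.
exists (class_rel_inv (class_graph w)); split; apply: class_rel_ext => a b.
  split=> [[c [/(related_graph _ _ re) ac /(related_graph _ _ re) bc]]|ab].
    by apply/jr/(homotopic_trans ac)/homotopic_sym.
  exists (r ∘ b); split; apply/(related_graph _ _ re); last exact: homotopic_refl.
  exact: homotopic_post.
split=> [[c [/(related_graph _ _ re) ca /(related_graph _ _ re) cb]]|ab].
  exact: homotopic_trans (homotopic_sym ca) cb.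
have [c ca] := sr a; exists c; split; apply/(related_graph _ _ re) => //.
exact: homotopic_trans ca ab.
Qed.

Lemma homotopy_bij_of_class_iso (x y : C) (f : Hom x y) (r : Hom (R x) (R y)) :
  r ∘ eta x = eta y ∘ f -> is_iso (fmap class_functor f) -> homotopy_bij M A r.
Proof.
move=> re [S [Sf fS]]; split=> [b|a a' raa].
  have : related (idc (y : class_category)) b b by apply: homotopic_refl.
  by rewrite -fS => -[a [_ /(related_graph _ _ re) ab]]; exists a.
have : related (idc (x : class_category)) a a by apply: homotopic_refl.
rewrite -Sf => -[b [/(related_graph _ _ re) ab ba]].
have : related (S ∘ fmap class_functor f) a' a.
  exists b; split=> //; apply/(related_graph _ _ re).
  exact: homotopic_trans (homotopic_sym raa) ab.
by rewrite Sf; apply: homotopic_sym.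
Qed.

End Saturation.

Lemma fmap_iso (C D : Category) (F : Functor C D) (x y : C) (f : Hom x y) :
  is_iso f -> is_iso (fmap F f).
Proof.
by move=> [g [gf fg]]; exists (fmap F g); rewrite -!fmap_comp gf fg !fmap_id.
Qed.

(** The weak equivalences are saturated.  The functor to relations factors through
    the homotopy category, so it inverts [f], for every cofibrant [A]. *)
Theorem weq_of_gamma_iso (C : Category) (M : ModelStructure C) (x y : C) (f : Hom x y) :
  is_iso (fmap (gamma M) f) -> weq M f.
Proof.
move=> iso_f.
have [R [eta Reta]] := fibrant_replacement_choice M.
have tcof_eta z := (Reta z).1; have fibR z := (Reta z).2.
have [r re] := extends_to_R tcof_eta fibR f.
have wr : weq M r.
  apply: weq_of_homotopy_bij => // A cofA.
  apply: (homotopy_bij_of_class_iso (tcof_eta := tcof_eta) (fibrant_R := fibR) (cofA := cofA) re).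
  have FW := class_functor_inverts tcof_eta fibR cofA.
  have := fmap_iso (loc_lift FW) iso_f.
  by rewrite /= (eval_eq FW (rep_cls _)).
apply: (weq_cancel_l (tcof_eta y).2); rewrite -re.
exact: weq_comp (tcof_eta x).2 wr.
Qed.
(** * Localization at the [Q]-equivalences *)

Section QLocalization.

Context (C : Category) (M : ModelStructure C).
Context (Q : Functor C C) (alpha : NatTrans (IdFunctor C) Q).

Hypothesis Q_weq : forall (X Y : C) (f : Hom X Y), weq M f -> weq M (fmap Q f).

Notation Qeq f := (Q_equivalence M Q f).

Lemma alpha_nat (X Y : C) (f : Hom X Y) : alpha Y ∘ f = fmap Q f ∘ alpha X.
Proof. exact: (ntnat alpha f). Qed.

Lemma Qeq_comp (X Y Z : C) (f : Hom X Y) (g : Hom Y Z) :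
  Qeq f -> Qeq g -> Qeq (g ∘ f).
Proof. by rewrite /Q_equivalence fmap_comp; apply: weq_comp. Qed.

Lemma Qeq_cancel_r (X Y Z : C) (f : Hom X Y) (g : Hom Y Z) :
  Qeq f -> Qeq (g ∘ f) -> Qeq g.
Proof. by rewrite /Q_equivalence fmap_comp; apply: weq_cancel_r. Qed.

Lemma Qeq_cancel_l (X Y Z : C) (f : Hom X Y) (g : Hom Y Z) :
  Qeq g -> Qeq (g ∘ f) -> Qeq f.
Proof. by rewrite /Q_equivalence fmap_comp; apply: weq_cancel_l. Qed.

Lemma Qeq_retract (X Y X' Y' : C) (f : Hom X Y) (g : Hom X' Y') :
  is_retract f g -> Qeq g -> Qeq f.
Proof.
move=> [i [r [j [s [ri sj e e']]]]]; apply: ms_retract_weq.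
exists (fmap Q i), (fmap Q r), (fmap Q j), (fmap Q s).
by split; rewrite -!fmap_comp ?ri ?sj ?e ?e' ?fmap_id.
Qed.

Definition Qtcof (X Y : C) (i : Hom X Y) : Prop := cof M i /\ Qeq i.

(** In the homotopy category, write [a] for [alpha (Q X)], [b] for [Q (alpha X)] and
    [c] for [alpha (Q (Q X))].  Applying [Q] to the naturality of [alpha] at [alpha X] and
    cancelling [b] gives [Q a = Q b].  By naturality [c ∘ b = Q b ∘ a] and
    [c ∘ a = Q a ∘ a], so [c ∘ a = c ∘ b]. *)
Lemma alpha_Q_weq :
  (forall X : C, weq M (fmap Q (alpha X)) /\ is_mono (fmap (gamma M) (alpha (Q X)))) ->
  forall X : C, weq M (alpha (Q X)).
Proof.
move=> A2 X; have [wQa _] := A2 X; have [_ mono_aQQ] := A2 (Q X).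
pose g x y (f : @Hom C x y) := fmap (gamma M) f.
have gM x y z (u : @Hom C y z) (v : Hom x y) : g _ _ (u ∘ v) = g _ _ u ∘ g _ _ v.
  exact: fmap_comp.
have iso_Qa : is_iso (g _ _ (fmap Q (alpha X))) by apply: loc_functor_inverts.
have eQ : g _ _ (fmap Q (alpha (Q X))) = g _ _ (fmap Q (fmap Q (alpha X))).
  have [k [_ Qak]] := iso_Qa.
  rewrite -[LHS]comp_idr -[RHS]comp_idr -Qak !compA -!gM -!fmap_comp.
  by rewrite alpha_nat.
apply: weq_of_gamma_iso; suff -> : fmap (gamma M) (alpha (Q X)) = g _ _ (fmap Q (alpha X)).
  exact: iso_Qa.
apply: mono_aQQ; rewrite -/(g _ _ _) -!gM !alpha_nat !gM.
by rewrite eQ.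
Qed.

(** The fibration [f' : X' -> Y'] is a fibrant model of [Q f], and [m : U -> V] one of
    [Q i], a weak equivalence, with [U -> X'] and [V -> Y'] fibrations.  The maps
    [X -> X'] and [Y -> Y'] are weak equivalences between fibrant objects,
    so the base changes [E] of [U] to [X] and [F] of [V] to [Y] are again related by a weak
    equivalence [phi].  The square from [i] to [f] factors through [phi = psi ∘ g]:
    the cofibration [i] lifts against the trivial fibration [psi], and the trivial
    cofibration [g] lifts against the fibration [f]. *)
Lemma local_fib_rlp (X Y : C) (f : Hom X Y) :
  fib M f -> fibrant M X -> fibrant M Y -> weq M (alpha X) -> weq M (alpha Y) ->
  rlp Qtcof f.
Proof.
move=> ff fX fY wX wY A B i [ci wi] u v sq.
have [Y' [kY [tkY fY']]] := fibrant_replacement M (Q Y).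
have [X' [kX [f' [ekf ckX wkX ff']]]] := ms_factor_tcof_fib M (kY ∘ fmap Q f).
have fX' : fibrant M X' := fibrant_fib ff' fY'.
have [V [j [pi [epj cj wj fpi]]]] := ms_factor_tcof_fib M (kY ∘ fmap Q v).
have [W [w1 [w2 pbW]]] := pullback_exists M pi f'.
have [|d [d1 d2]] := pullback_lift pbW (a := j ∘ fmap Q i) (b := kX ∘ fmap Q u).
  by rewrite !compA -epj -ekf -!compA -!fmap_comp sq.
have [U [l [om [edl cl wl fom]]]] := ms_factor_tcof_fib M d.
pose m := w1 ∘ om; pose n := w2 ∘ om.
have ml : m ∘ l = j ∘ fmap Q i by rewrite -compA -edl.
have nl : n ∘ l = kX ∘ fmap Q u by rewrite -compA -edl.
have wm : weq M m by apply: (weq_cancel_r wl); rewrite ml; apply: weq_comp wj.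
have fn : fib M n by apply: fib_comp fom (fib_pullback_r pbW fpi).
have mn : pi ∘ m = f' ∘ n by rewrite !compA (pullback_comm pbW).
(* [m] and [n] are made opaque so that rewriting does not see through them. *)
move: m n ml nl wm fn mn => m n ml nl wm fn mn.
have [bX ebX] : exists b, b = kX ∘ alpha X by eexists.
have [bY ebY] : exists b, b = kY ∘ alpha Y by eexists.
have wbX : weq M bX by rewrite ebX; apply: weq_comp.
have wbY : weq M bY by rewrite ebY; apply: weq_comp tkY.2.
have fb : f' ∘ bX = bY ∘ f by rewrite ebX ebY compA -ekf -!compA alpha_nat.
have [E [eX [eU pbE]]] := pullback_exists M bX n.
have [F [fY0 [fV pbF]]] := pullback_exists M bY pi.
have weU : weq M eU := weq_pullback_fibrant fX fX' wbX fn pbE.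
have wfV : weq M fV := weq_pullback_fibrant fY fY' wbY fpi pbF.
have [|phi [phi1 phi2]] := pullback_lift pbF (a := f ∘ eX) (b := m ∘ eU).
  by rewrite !compA -fb mn -!compA (pullback_comm pbE).
have wphi : weq M phi by apply: (weq_cancel_l wfV); rewrite phi2; apply: weq_comp.
have [|a [a1 a2]] := pullback_lift pbE (a := u) (b := l ∘ alpha A).
  by rewrite ebX compA nl -!compA alpha_nat.
have [|b [b1 b2]] := pullback_lift pbF (a := v) (b := j ∘ alpha B).
  by rewrite ebY compA -epj -!compA alpha_nat.
have [G [g [psi [epg cg wg fpsi]]]] := ms_factor_tcof_fib M phi.
have wpsi : weq M psi by apply: (weq_cancel_r wg); rewrite -epg.
have [|h [hi ph]] := (tfibP M psi).1 (conj fpsi wpsi) _ _ _ ci (g ∘ a) b.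
  rewrite compA -epg; apply: (pullback_ext pbF); rewrite !compA.
    by rewrite phi1 b1 -compA a1.
  by rewrite phi2 b2 -!compA a2 alpha_nat !compA ml.
have [|k [kg fk]] := (fibP M f).1 ff _ _ _ (conj cg wg) eX (fY0 ∘ psi).
  by rewrite -phi1 epg compA.
exists (k ∘ h); split; first by rewrite -compA hi compA kg.
by rewrite compA fk -compA ph.
Qed.

Hypothesis Qalpha_weq : forall X : C, weq M (fmap Q (alpha X)).
Hypothesis alphaQ_weq : forall X : C, weq M (alpha (Q X)).

Hypothesis Qeq_pullback : forall (X Y : C) (f : Hom X Y),
  fib M f -> fibrant M X -> fibrant M Y -> weq M (alpha X) -> weq M (alpha Y) ->
  forall (W : C) (w : Hom W Y), Qeq w ->
  forall (P : C) (q : Hom P W) (p : Hom P X), is_pullback w f q p -> Qeq p.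

(** Being local, in the sense that [alpha] is a weak equivalence, is invariant under
    weak equivalences, and holds for the values of [Q]. *)
Lemma alpha_weq_of_Q (X Z : C) (k : Hom (Q X) Z) : weq M k -> weq M (alpha Z).
Proof.
move=> wk; apply: (weq_cancel_r wk); rewrite alpha_nat.
exact: weq_comp (alphaQ_weq X) (Q_weq wk).
Qed.

(** [f] is factored through the base change [P] to [Y] of the local model [f'] of
    [f]; (A3) enters as [Qeq_pullback], to make [X -> P] a [Q]-equivalence. *)
Lemma Q_factorization (X Y : C) (f : Hom X Y) :
  exists (Z : C) (i : Hom X Z) (p : Hom Z Y), [/\ f = p ∘ i, Qtcof i & rlp Qtcof p].
Proof.
have [Y' [kY [[_ wkY] fY']]] := fibrant_replacement M (Q Y).
have [X' [kX [f' [ekf _ wkX ff']]]] := ms_factor_tcof_fib M (kY ∘ fmap Q f).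
have fX' : fibrant M X' := fibrant_fib ff' fY'.
have wX' := alpha_weq_of_Q wkX; have wY' := alpha_weq_of_Q wkY.
have QbX : Qeq (kX ∘ alpha X) by apply: Qeq_comp; [apply: Qalpha_weq | apply: Q_weq].
have QbY : Qeq (kY ∘ alpha Y) by apply: Qeq_comp; [apply: Qalpha_weq | apply: Q_weq].
have [P [pY [pX pb]]] := pullback_exists M (kY ∘ alpha Y) f'.
have [|h [hY hX]] := pullback_lift pb (a := f) (b := kX ∘ alpha X).
  by rewrite compA -ekf -!compA alpha_nat.
have Qh : Qeq h.
  apply: (Qeq_cancel_l (Qeq_pullback ff' fX' fY' wX' wY' QbY pb)).
  by rewrite hX.
have [Z [i [t [eh ci ft wt]]]] := ms_factor_cof_tfib M h.
exists Z, i, (pY ∘ t); split; first by rewrite -compA -eh.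
- by split=> //; apply: (Qeq_cancel_l (Q_weq wt)); rewrite -eh.
apply: rlp_comp.
  by move=> a b j [cj _]; apply: (tfibP M t).1 cj.
exact: rlp_pullback (pullback_sym pb) (local_fib_rlp ff' fX' fY' wX' wY').
Qed.

(** The retract argument: [p] lifts against the cofibration in its factorization
    into a cofibration and a trivial fibration. *)
Lemma tfib_of_Qfib_Qeq (X Y : C) (p : Hom X Y) : rlp Qtcof p -> Qeq p -> tfib M p.
Proof.
move=> lp Qp; have [z [i [t [e ci ft wt]]]] := ms_factor_cof_tfib M p.
have Qi : Qeq i by apply: (Qeq_cancel_l (Q_weq wt)); rewrite -e.
have ret := retract_of_right_factor e (lp _ _ _ (conj ci Qi)).
by split; [apply: ms_retract_fib ret ft | apply: ms_retract_weq ret wt].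
Qed.

Program Definition Q_model_structure : ModelStructure C :=
  {| weq := fun X Y f => Qeq f;
     fib := fun X Y f => rlp Qtcof f;
     cof := fun X Y f => cof M f;
     ms_limits := ms_limits M;
     ms_colimits := ms_colimits M;
     ms_retract_cof := @ms_retract_cof _ M |}.
Next Obligation.
move=> X Y Z f g; split; [exact: Qeq_comp|exact: Qeq_cancel_r|exact: Qeq_cancel_l].
Qed.
Next Obligation. by move=> X Y X' Y' f g; apply: Qeq_retract. Qed.
Next Obligation. by move=> X Y X' Y' f g; apply: rlp_retract. Qed.
Next Obligation. by move=> A B X Y i p ci Qi lp; apply: lp. Qed.
Next Obligation.
by move=> A B X Y i p ci lp Qp; apply: (tfibP M p).1 ci; apply: tfib_of_Qfib_Qeq.
Qed.
Next Obligation.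
move=> X Y f; have [Z [i [p [e [ci Qi] lp]]]] := Q_factorization f.
by exists Z, i, p.
Qed.
Next Obligation.
move=> X Y f; have [Z [i [p [e ci fp wp]]]] := ms_factor_cof_tfib M f.
exists Z, i, p; split=> //; last exact: Q_weq.
by move=> a b j [cj _]; apply: (tfibP M p).1 cj.
Qed.

End QLocalization.

Theorem theorem1p1 (C : Category) (M : ModelStructure C)
  (Q : Functor C C) (alpha : NatTrans (IdFunctor C) Q)
  (A1 : forall (X Y : C) (f : Hom X Y), weq M f -> weq M (fmap Q f))
  (A2 : forall X : C,
      weq M (fmap Q (alpha X)) /\ is_mono (fmap (gamma M) (alpha (Q X))))
  (A3 : forall (X Y : C) (f : Hom X Y),
      fib M f -> fibrant M X -> fibrant M Y ->
      weq M (alpha X) -> weq M (alpha Y) ->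
      forall (W : C) (w : Hom W Y), Q_equivalence M Q w ->
      forall (P : C) (q : Hom P W) (p : Hom P X),
        is_pullback w f q p -> Q_equivalence M Q p) :
  exists N : ModelStructure C,
    is_left_Bousfield_localization M N /\
    (forall (X Y : C) (f : Hom X Y), weq N f <-> Q_equivalence M Q f).
Proof.
exists (Q_model_structure A1 (fun X => (A2 X).1) (alpha_Q_weq A2) A3).
by split=> //; split.
Qed.
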